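(* Let $k\ge 2$ be a fixed integer and let $\Delta=\Delta(n)$ be an integer-valued nondecreasing function of $n$ with $\Delta(n)\to\infty$ and $\Delta=O\left(n^{\frac{1}{k^2-k}}\right)$. Then for every sufficiently large integer $n$ (with $n\ge k+1$) there is a graph $H=H(n)$ (depending only on $n$ and $\Delta$) with $n$ vertices and maximum degree $\Delta(n)$ such that the following holds: if $\sigma(n)=o\left(n^{1/k^2}\Delta^{1/k}\right)$ and $L$ is a random $(k,\mathcal{C})$-list assignment for $H$, where $|\mathcal{C}|=\sigma(n)$, then with high probability $H$ is not $L$-colorable.
   Context: Graphs are finite and simple. A list assignment $L$ for a graph $H$ assigns to each vertex $v$ a set $L(v)$ of colors. $H$ is $L$-colorable if there is a proper vertex coloring $\varphi$ of $H$ with $\varphi(v)\in L(v)$ for every $v\in V(H)$. A random $(k,\mathcal{C})$-list assignment for $H$, where $\mathcal{C}=\{1,2,\dots,\sigma\}$ (with $\sigma=\sigma(n)\ge k$), is obtained by choosing, for each vertex $v$, the list $L(v)$ independently and uniformly at random from all $k$-element subsets of $\mathcal{C}$. An event $A_n$ occurs with high probability if $\lim_{n\to\infty}\mathbb{P}[A_n]=1$. Asymptotic notation is with respect to $n\to\infty$. *)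

(* Defs.v *)
From HB Require Import structures.
From mathcomp Require Import all_boot all_order all_algebra.

Set Implicit Arguments.
Unset Strict Implicit.
Unset Printing Implicit Defensive.

Import GRing.Theory.
Local Open Scope ring_scope.

Definition simple_graph (V : finType) (e : rel V) : Prop :=
  symmetric e /\ irreflexive e.

Definition max_degree (V : finType) (e : rel V) : nat :=
  \max_(v : V) #|[set w | e v w]|.

Definition proper_coloring (V C : finType) (e : rel V) (phi : {ffun V -> C}) :
    bool :=
  [forall v, forall w, e v w ==> (phi v != phi w)].

Definition list_colorable (V C : finType) (e : rel V)
    (L : {ffun V -> {set C}}) : bool :=
  [exists phi : {ffun V -> C},
     proper_coloring e phi && [forall v, phi v \in L v]].

Definition ksubsets (C : finType) (k : nat) : {set {set C}} :=
  [set S : {set C} | #|S| == k].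

(* A genuine probability mass function only when k <= #|C|; otherwise there is
   no k-element subset and the mass function vanishes identically. *)
Definition unif_ksubset (R : fieldType) (C : finType) (k : nat) (S : {set C}) :
    R :=
  if S \in ksubsets C k then #|ksubsets C k|%:R^-1 else 0.

(* Probability of the event A for a random k-list assignment: the lists of
   distinct vertices being independent, their joint law is the product of the
   uniform laws on the k-element subsets of C. *)
Definition list_prob (R : fieldType) (V C : finType) (k : nat)
    (A : pred {ffun V -> {set C}}) : R :=
  \sum_(L | A L) \prod_(v : V) unif_ksubset R k (L v).

(* Main.v *)
Require Import Defs.
From HB Require Import structures.
From mathcomp Require Import all_boot all_order all_algebra.
From mathcomp Require Import ring lra zify.

Set Implicit Arguments.
Unset Strict Implicit.
Unset Printing Implicit Defensive.

Import Order.TTheory GRing.Theory Num.Theory.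
Local Open Scope ring_scope.

(** The graph H(n) is a disjoint union of cliques on Delta + 1 consecutive
    vertices (the last one possibly smaller).  If k + 1 vertices of one clique
    receive the same list, H is not colorable, since these vertices need k + 1
    different colors from a set of size k.  So it suffices that such vertices
    appear with high probability, which follows from the second moment method.

    Only some of the (k + 1)-sets are counted, to keep the sums explicit.  Inside
    each of the B full cliques, fix q = k + 1 disjoint groups of t vertices, where
    t is about Delta / q, and let X be the number of transversals of the groups of
    some clique on which the list is constant.  With N = 'C(sigma, k) possible
    lists, the mean of X is B t^q N^(1-q).  Two disjoint transversals contribute
    independently, and two transversals with a vertex in common are both constant
    iff their union is; so the variance of X only comes from pairs that meet, and
    the pairs meeting a fixed transversal sum up in closed form because the number
    of common vertices is a sum over the q groups.  Chebyshev's inequality gives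
      P(X = 0) <= q (N + t)^k / (B t^q)
    ([disjoint_cliques_colorable_le]).  Since B t is of order n and N <= sigma^k,
    the right-hand side is of order at most
      1/n + sigma^(k^2) / (n Delta^k)
    ([clique_blocks_colorable_asymp]), and the second term tends to 0 exactly when
    sigma = o(n^(1/k^2) Delta^(1/k)). *)

(** * Random list assignments *)

Definition list_mass (R : fieldType) (V C : finType) (k : nat)
    (L : {ffun V -> {set C}}) : R :=
  \prod_v unif_ksubset R k (L v).

Definition list_mean (R : fieldType) (V C : finType) (k : nat)
    (F : {ffun V -> {set C}} -> R) : R :=
  \sum_L list_mass R k L * F L.

Lemma unif_ksubset_ge0 (R : realFieldType) (C : finType) (k : nat)
    (S : {set C}) : 0 <= unif_ksubset R k S.
Proof. by rewrite /unif_ksubset; case: ifP => // _; rewrite invr_ge0 ler0n. Qed.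

Lemma list_mass_ge0 (R : realFieldType) (V C : finType) (k : nat)
    (L : {ffun V -> {set C}}) : 0 <= list_mass R k L.
Proof. by apply: prodr_ge0 => v _; apply: unif_ksubset_ge0. Qed.

Lemma card_ksubsets (C : finType) (k : nat) : #|ksubsets C k| = 'C(#|C|, k).
Proof. by rewrite /ksubsets card_draws. Qed.

Lemma ksubsets_gt0 (C : finType) (k : nat) :
  (k <= #|C|)%N -> (0 < #|ksubsets C k|)%N.
Proof. by rewrite card_ksubsets bin_gt0. Qed.

Lemma sum_unif_ksubset (R : realFieldType) (C : finType) (k : nat) :
  (k <= #|C|)%N -> \sum_(S : {set C}) unif_ksubset R k S = 1.
Proof.
move=> /ksubsets_gt0 N0; rewrite /unif_ksubset -big_mkcond /= sumr_const.
by rewrite -[RHS](mulVf (x := #|ksubsets C k|%:R)) ?pnatr_eq0 -?lt0n // mulr_natr.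
Qed.

Lemma sum_list_mass (R : realFieldType) (V C : finType) (k : nat) :
  (k <= #|C|)%N -> \sum_(L : {ffun V -> {set C}}) list_mass R k L = 1.
Proof.
move=> kC; rewrite /list_mass -(bigA_distr_bigA (fun=> unif_ksubset R k)).
by rewrite big1 // => v _; apply: sum_unif_ksubset.
Qed.

Lemma list_prob_predC (R : realFieldType) (V C : finType) (k : nat)
    (A : pred {ffun V -> {set C}}) : (k <= #|C|)%N ->
  list_prob R k (fun L => ~~ A L) = 1 - list_prob R k A.
Proof.
move=> kC; rewrite -(@sum_list_mass R V _ _ kC) (bigID A) /= /list_prob addrC.
by rewrite -addrA subrr addr0.
Qed.

Lemma list_prob_ge0 (R : realFieldType) (V C : finType) (k : nat)
    (A : pred {ffun V -> {set C}}) : 0 <= list_prob R k A.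
Proof. by apply: sumr_ge0 => L _; apply: list_mass_ge0. Qed.

Lemma list_mean_sum (R : realFieldType) (V C I : finType) (k : nat)
    (P : pred I) (F : I -> {ffun V -> {set C}} -> R) :
  list_mean k (fun L => \sum_(i | P i) F i L) = \sum_(i | P i) list_mean k (F i).
Proof. by rewrite exchange_big /=; apply: eq_bigr => L _; rewrite mulr_sumr. Qed.

Lemma eq_list_mean (R : realFieldType) (V C : finType) (k : nat)
    (F G : {ffun V -> {set C}} -> R) :
  F =1 G -> list_mean k F = list_mean k G.
Proof. by move=> FG; apply: eq_bigr => L _; rewrite FG. Qed.

(** Every L in A is at distance exactly the mean of X from that mean, so A carries
    at least P(A) (E X)^2 of the variance. *)
Lemma chebyshev_at0 (R : realFieldType) (V C : finType) (k : nat)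
    (A : pred {ffun V -> {set C}}) (X : {ffun V -> {set C}} -> R) :
    (k <= #|C|)%N -> (forall L, A L -> X L = 0) ->
  list_prob R k A * list_mean k X ^+ 2 <=
  list_mean k (fun L => X L ^+ 2) - list_mean k X ^+ 2.
Proof.
move=> kC AX; set mu := list_mean k X.
have -> : list_mean k (fun L => X L ^+ 2) - mu ^+ 2 =
          \sum_L list_mass R k L * (X L - mu) ^+ 2.
  (* Expanding the square leaves mu^2 times the total mass, which is 1. *)
  transitivity (list_mean k (fun L => X L ^+ 2) - mu * mu *+ 2
    + (\sum_(L : {ffun V -> {set C}}) list_mass R k L) * mu ^+ 2).
    by rewrite sum_list_mass //; ring.
  rewrite {2}/mu /list_mean mulr_sumr -sumrMnl -sumrB mulr_suml -big_split /=.
  by apply: eq_bigr => L _; ring.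
rewrite [leRHS](bigID A) /= /list_prob mulr_suml -[leLHS]addr0.
apply: lerD; last first.
  by apply: sumr_ge0 => L _; rewrite mulr_ge0 ?list_mass_ge0 ?sqr_ge0.
by apply: ler_sum => L /AX ->; rewrite sub0r sqrrN.
Qed.

(** The indicator of L = g on D is a product over the vertices of functions of
    single lists, so its mean is the product of the means; each vertex of D
    contributes 1/N, where N is the number of possible lists, and each other vertex
    contributes 1. *)
Lemma mean_agree (R : realFieldType) (V C : finType) (k : nat) (D : {set V})
    (g : V -> {set C}) : (k <= #|C|)%N ->
    {in D, forall v, g v \in ksubsets C k} ->
  list_mean k (fun L : {ffun V -> {set C}} => [forall v in D, L v == g v]%:R) =
  #|ksubsets C k|%:R ^- #|D| :> R.
Proof.
move=> kC gD.
pose W v (S : {set C}) : R := unif_ksubset R k S * ((v \in D) ==> (S == g v))%:R.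
transitivity (\sum_(L : {ffun V -> {set C}}) \prod_v W v (L v)).
  apply: eq_bigr => L _; rewrite /W big_split /=; congr (_ * _).
  rewrite -natr_prod; congr _%:R; case: (boolP [forall v, _]) => [/forallP a|].
    by rewrite big1 // => v _; rewrite a.
  by rewrite negb_forall => /existsP[v /negbTE nv]; rewrite (bigD1 v) //= nv.
rewrite -(bigA_distr_bigA W) -exprVn -prodr_const [RHS]big_mkcond /=.
apply: eq_bigr => v _; rewrite /W; case: ifP => vD /=.
  rewrite (bigD1 (g v)) //= eqxx mulr1 big1 ?addr0 => [|S /negbTE->]; last first.
    by rewrite mulr0.
  by rewrite /unif_ksubset gD.
by under eq_bigr do rewrite mulr1; exact: sum_unif_ksubset.
Qed.

Definition same_list (V C : finType) (k : nat) (L : {ffun V -> {set C}})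
    (A : {set V}) : bool :=
  [exists S in ksubsets C k, [forall v in A, L v == S]].

(** A nonempty set determines its common list, so the indicator of existence is a sum
    of indicators of disjoint events. *)
Lemma same_listE (R : realFieldType) (V C : finType) (k : nat)
    (L : {ffun V -> {set C}}) (A : {set V}) : A != set0 ->
  (same_list k L A)%:R =
  \sum_(S in ksubsets C k) [forall v in A, L v == S]%:R :> R.
Proof.
case/set0Pn=> a aA; rewrite /same_list.
case: (boolP [exists S in _, _]) => [/existsP[S /andP[SN cS]]|].
  rewrite (bigD1 S) //= cS big1 ?addr0 // => T /andP[_ TS].
  case: (boolP [forall v in A, L v == T]) => // /forallP/(_ a).
  move/forallP/(_ a): cS; rewrite aA /= => /eqP-> /eqP ST.
  by rewrite ST eqxx in TS.
rewrite negb_exists => /forallP nex; rewrite big1 // => S SN.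
by have := nex S; rewrite SN /= => /negbTE ->.
Qed.

Lemma mean_same_list (R : realFieldType) (V C : finType) (k : nat)
    (A : {set V}) : (k <= #|C|)%N -> A != set0 ->
  list_mean k (fun L : {ffun V -> {set C}} => (same_list k L A)%:R) =
  #|ksubsets C k|%:R * #|ksubsets C k|%:R ^- #|A| :> R.
Proof.
move=> kC A0.
rewrite (eq_list_mean _ (fun L => same_listE R k L A0)) list_mean_sum.
rewrite (eq_bigr (fun=> #|ksubsets C k|%:R ^- #|A|)) => [|S SN].
  by rewrite sumr_const mulr_natl.
by rewrite (@mean_agree _ _ _ _ A (fun=> S)).
Qed.

Lemma mean_same_list_disjoint (R : realFieldType) (V C : finType) (k : nat)
    (A B : {set V}) : (k <= #|C|)%N -> A != set0 -> B != set0 ->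
    [disjoint A & B] ->
  list_mean k (fun L : {ffun V -> {set C}} =>
    (same_list k L A)%:R * (same_list k L B)%:R) =
  #|ksubsets C k|%:R ^+ 2 * #|ksubsets C k|%:R ^- (#|A| + #|B|) :> R.
Proof.
move=> kC A0 B0 AB; set N : R := #|_|%:R.
pose g S T v : {set C} := if v \in A then S else T.
transitivity (\sum_(S in ksubsets C k) \sum_(T in ksubsets C k)
  list_mean k (fun L : {ffun V -> {set C}} =>
    [forall v in A :|: B, L v == g S T v]%:R) : R).
  under eq_bigr do rewrite -list_mean_sum.
  rewrite -list_mean_sum; apply: eq_list_mean => L.
  rewrite !same_listE // mulr_suml; apply: eq_bigr => S _.
  rewrite mulr_sumr; apply: eq_bigr => T _; rewrite -natrM mulnb.
  congr (nat_of_bool _)%:R; apply/andP/forallP => [[/forallP a /forallP b] v|a].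
    apply/implyP; rewrite inE /g; case: ifP => vA /= vB.
      by have := a v; rewrite vA.
    by have := b v; rewrite vB.
  split; apply/forallP => v; apply/implyP => vAB; have := a v.
    by rewrite inE /g vAB.
  by rewrite inE /g vAB orbT (disjointFl AB vAB).
rewrite (eq_bigr (fun=> \sum_(T in ksubsets C k) N ^- (#|A| + #|B|))).
  by rewrite sumr_const sumr_const -mulrnA -mulr_natl natrM expr2.
move=> S SN; apply: eq_bigr => T TN; rewrite mean_agree //.
  by congr (_ ^- _); apply/eqP; rewrite (leq_card_setU A B).
by move=> v _; rewrite /g; case: ifP.
Qed.

Lemma same_list_setU (V C : finType) (k : nat) (L : {ffun V -> {set C}})
    (A B : {set V}) : ~~ [disjoint A & B] ->
  same_list k L A && same_list k L B = same_list k L (A :|: B).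
Proof.
rewrite -setI_eq0 => /set0Pn[x]; rewrite inE => /andP[xA xB].
apply/andP/existsP => [[/existsP[S /andP[SN /forallP a]]
  /existsP[T /andP[TN /forallP b]]]|[S /andP[SN /forallP a]]].
  exists S; rewrite SN /=; apply/forallP => v; apply/implyP.
  have ST : S = T.
    by have := a x; have := b x; rewrite xA xB /= => /eqP -> /eqP.
  rewrite inE => /orP[vA|vB]; first by have := a v; rewrite vA.
  by have := b v; rewrite vB ST.
split; apply/existsP; exists S; rewrite SN /=; apply/forallP => v;
by apply/implyP => vAB; have := a v; rewrite inE vAB ?orbT.
Qed.

(** Second moment method for the number X of sets A i on which L is constant.
    Chebyshev's inequality, multiplied by a power of N: disjoint pairs contribute
    at most (E X)^2, which cancels, and a pair that meets contributes
    N^(1 - |A i :|: A j|) = N^(1 - 2q) N^|A i :&: A j|. *)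
Lemma second_moment_same_list (R : realFieldType) (V C I : finType) (k q : nat)
    (A : I -> {set V}) : (k <= #|C|)%N -> (0 < q)%N ->
    (forall i, #|A i| = q) ->
  list_prob R k (fun L : {ffun V -> {set C}} =>
      [forall i, ~~ same_list k L (A i)]) *
    ((#|I| ^ 2 * #|ksubsets C k|)%N%:R) <=
  (\sum_i \sum_(j | ~~ [disjoint A i & A j])
     #|ksubsets C k| ^ #|A i :&: A j|)%N%:R.
Proof.
move=> kC q0 Aq.
have A0 i : A i != set0 by rewrite -card_gt0 Aq.
pose X (L : {ffun V -> {set C}}) : R := \sum_i (same_list k L (A i))%:R.
have X0 L : [forall i, ~~ same_list k L (A i)] -> X L = 0.
  by move=> /forallP nL; rewrite /X big1 // => i _; rewrite (negbTE (nL i)).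
have := chebyshev_at0 kC X0; set P := list_prob _ _ _.
have N0 : (0 < #|ksubsets C k|)%N by apply: ksubsets_gt0.
set N := #|ksubsets C k| in N0 *.
have Nr0 : N%:R != 0 :> R by rewrite pnatr_eq0 -lt0n.
have -> : list_mean k X = #|I|%:R * (N%:R * N%:R ^- q).
  rewrite list_mean_sum (eq_bigr (fun=> N%:R * N%:R ^- q)) => [|i _].
    by rewrite sumr_const [RHS]mulr_natl.
  by rewrite mean_same_list // Aq.
have -> : list_mean k (fun L => X L ^+ 2) = \sum_i \sum_j
   (if [disjoint A i & A j] then N%:R ^+ 2 * N%:R ^- (q + q)
    else N%:R * N%:R ^- (q + q) * N%:R ^+ #|A i :&: A j|).
  transitivity (\sum_i \sum_j list_mean k (fun L : {ffun V -> {set C}} =>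
      (same_list k L (A i))%:R * (same_list k L (A j))%:R) : R).
    under eq_bigr do rewrite -list_mean_sum.
    rewrite -list_mean_sum; apply: eq_list_mean => L.
    by rewrite expr2 mulr_suml; apply: eq_bigr => i _; rewrite mulr_sumr.
  apply: eq_bigr => i _; apply: eq_bigr => j _; case: ifP => dij.
    by rewrite mean_same_list_disjoint // !Aq.
  transitivity (list_mean k (fun L : {ffun V -> {set C}} =>
      (same_list k L (A i :|: A j))%:R) : R).
    by apply: eq_list_mean => L; rewrite -natrM mulnb same_list_setU ?dij.
  rewrite mean_same_list //; last first.
    by rewrite -card_gt0 (leq_trans _ (subset_leq_card (subsetUl _ _))) ?Aq.
  rewrite -mulrA; congr (_ * _).
  have := cardsUI (A i) (A j); rewrite !Aq => <-.
  by rewrite exprD invfM -mulrA mulVf ?mulr1 ?expf_neq0.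
have -> : \sum_i \sum_j
   (if [disjoint A i & A j] then N%:R ^+ 2 * N%:R ^- (q + q)
    else N%:R * N%:R ^- (q + q) * N%:R ^+ #|A i :&: A j|) =
   N%:R * N%:R ^- (q + q) * ((\sum_i \sum_(j | ~~ [disjoint A i & A j])
     N ^ #|A i :&: A j|)%N%:R +
   (\sum_i \sum_(j | [disjoint A i & A j]) N)%N%:R) :> R.
  rewrite -natrD -big_split natr_sum mulr_sumr; apply: eq_bigr => i _ /=.
  rewrite (bigID (fun j => [disjoint A i & A j])) /= natrD !natr_sum mulrDr addrC.
  congr (_ + _); rewrite mulr_sumr.
    by apply: eq_bigr => j /negbTE ->; rewrite natrX.
  by apply: eq_bigr => j ->; ring.
have le2 : (\sum_i \sum_(j | [disjoint A i & A j]) N)%N%:R <=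
    #|I|%:R ^+ 2 * N%:R :> R.
  rewrite -natrX -natrM ler_nat expnS expn1 -mulnA -sum_nat_const leq_sum // => i _.
  by rewrite -sum_nat_const [leqRHS](bigID (fun j => [disjoint A i & A j])) leq_addr.
move: le2; set Y := (\sum_i _)%N%:R; set Z := (\sum_i _)%N%:R => le2 le1.
have c0 : 0 < N%:R * N%:R ^- (q + q) :> R by rewrite divr_gt0 ?exprn_gt0 ?ltr0n.
rewrite -(ler_pM2l c0) natrM natrX.
have E : (#|I|%:R * (N%:R / N%:R ^+ q)) ^+ 2 =
  N%:R / N%:R ^+ (q + q) * (#|I|%:R ^+ 2 * N%:R) :> R.
  by rewrite exprD invfM; ring.
rewrite E in le1; rewrite mulrCA (le_trans le1) // lerBlDr -mulrDr.
by rewrite ler_pM2l // lerD2l.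
Qed.

(** * Counting transversals *)

Definition agreement (q t : nat) (f g : {ffun 'I_q -> 'I_t}) : {set 'I_q} :=
  [set i | f i == g i].

(** The exponential of the number of agreements is a product over the coordinates,
    and each coordinate of g has one agreeing value, of weight N, and t - 1 others,
    of weight 1. *)
Lemma sum_exp_agreement (q t N : nat) (f : {ffun 'I_q -> 'I_t}) :
  (\sum_g N ^ #|agreement f g| = (N + t.-1) ^ q)%N.
Proof.
transitivity (\sum_(g : {ffun 'I_q -> 'I_t})
    \prod_i (if f i == g i then N else 1))%N.
  apply: eq_bigr => g _; rewrite -big_mkcond /= -prod_nat_const.
  by apply: eq_bigl => i; rewrite inE.
(* Exchange the sum over g and the product over the coordinates. *)
rewrite -(bigA_distr_bigA (fun i j => if f i == j then N else 1)%N).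
rewrite (eq_bigr (fun=> N + t.-1)%N) ?prod_nat_const ?card_ord // => i _.
rewrite (bigD1 (f i)) //= eqxx; congr (_ + _)%N.
rewrite (eq_bigr (fun=> 1%N)) => [|j /negbTE]; last by rewrite eq_sym => ->.
by rewrite sum1_card cardC1 card_ord.
Qed.

Lemma sum_disagreement (q t : nat) (f : {ffun 'I_q -> 'I_t}) :
  (\sum_(g | agreement f g == set0) 1 = t.-1 ^ q)%N.
Proof.
rewrite -[t.-1]add0n -(sum_exp_agreement 0 f) big_mkcond /=.
by apply: eq_bigr => g _; rewrite -cards_eq0; case: #|_| => // n; rewrite exp0n.
Qed.

Lemma expn_mean_value_le (x N q : nat) :
  ((N + x) ^ q <= q * N * (N + x) ^ q.-1 + x ^ q)%N.
Proof.
case: q => [|q] //=; elim: q => [|q IH]; first by rewrite !expn1 expn0; lia.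
have := leq_mul (leqnn (N + x)) IH; rewrite -expnS => /leq_trans; apply.
have : (x ^ q.+1 <= (N + x) ^ q.+1)%N by rewrite leq_exp2r // leq_addl.
rewrite [(x ^ q.+2)%N]expnS !(expnS (N + x)).
move: ((N + x) ^ q)%N (x ^ q.+1)%N => a b le_ba.
have := leq_mul (leqnn N) le_ba.
nia.
Qed.

(** The closed form (N + t - 1)^q - (t - 1)^q, bounded by the mean value
    inequality.  The factor q N, instead of a full (N + t)^q, is what makes the
    final bound small also when N is much smaller than t. *)
Lemma sum_exp_agreement_gt0 (q t N : nat) (f : {ffun 'I_q -> 'I_t}) :
  (\sum_(g | agreement f g != set0) N ^ #|agreement f g| <=
   q * N * (N + t) ^ q.-1)%N.
Proof.
have := sum_exp_agreement N f.
rewrite (bigID (fun g => agreement f g == set0)) /=.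
rewrite (eq_bigr (fun=> 1%N)) => [|g /eqP ->]; last by rewrite cards0.
rewrite sum_disagreement => total; rewrite -(leq_add2l (t.-1 ^ q)) total.
rewrite (leq_trans (expn_mean_value_le t.-1 N q)) // addnC leq_add2l leq_mul2l.
case: q {f total} => [|[|q]] //; first by rewrite !expn0 orbT.
by rewrite leq_exp2r // leq_add2l leq_pred orbT.
Qed.

(** The vertex v (b, i, j) is the j-th one in the i-th group of the clique b; a
    transversal picks one vertex in each group of a single clique. *)
Definition transversal (V : finType) (B q t : nat)
    (v : 'I_B * 'I_q * 'I_t -> V) (bf : 'I_B * {ffun 'I_q -> 'I_t}) : {set V} :=
  [set v (bf.1, i, bf.2 i) | i : 'I_q].

Lemma card_transversal (V : finType) (B q t : nat)
    (v : 'I_B * 'I_q * 'I_t -> V) (bf : 'I_B * {ffun 'I_q -> 'I_t}) :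
  injective v -> #|transversal v bf| = q.
Proof.
by move=> v_inj; rewrite card_imset ?card_ord // => i j /v_inj [].
Qed.

Lemma transversalI_same (V : finType) (B q t : nat)
    (v : 'I_B * 'I_q * 'I_t -> V) (b : 'I_B) (f g : {ffun 'I_q -> 'I_t}) :
  injective v ->
  transversal v (b, f) :&: transversal v (b, g) =
  [set v (b, i, f i) | i in agreement f g].
Proof.
move=> v_inj; apply/setP=> x; rewrite inE; apply/andP/imsetP.
  by case=> /imsetP[i _ ->] /imsetP[j _ /v_inj[<- fg]]; exists i; rewrite ?inE ?fg.
case=> i; rewrite inE => /eqP fg ->; split; apply/imsetP; exists i => //=.
by rewrite fg.
Qed.

Lemma transversal_disjoint (V : finType) (B q t : nat)
    (v : 'I_B * 'I_q * 'I_t -> V) (x y : 'I_B * {ffun 'I_q -> 'I_t}) :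
  injective v -> x.1 != y.1 -> [disjoint transversal v x & transversal v y].
Proof.
move=> v_inj xy; rewrite -setI_eq0; apply/eqP/setP => u; rewrite !inE.
apply/negP => /andP[/imsetP[i _ ->] /imsetP[j _ /v_inj[e _ _]]].
by rewrite e eqxx in xy.
Qed.

(** Transversals that meet lie in the same clique and agree in some group. *)
Lemma sum_transversal_pairs (V : finType) (B q t N : nat)
    (v : 'I_B * 'I_q * 'I_t -> V) : injective v ->
  (\sum_x \sum_(y | ~~ [disjoint transversal v x & transversal v y])
      N ^ #|transversal v x :&: transversal v y| <=
   B * t ^ q * (q * N * (N + t) ^ q.-1))%N.
Proof.
move=> v_inj.
have -> : (B * t ^ q = #|{: 'I_B * {ffun 'I_q -> 'I_t}}|)%N.
  by rewrite card_prod card_ffun !card_ord.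
rewrite -sum_nat_const leq_sum // => -[b f] _.
apply: leq_trans (sum_exp_agreement_gt0 N f).
have Einter g : #|transversal v (b, f) :&: transversal v (b, g)| =
    #|agreement f g|.
  by rewrite transversalI_same // card_imset // => i j /v_inj[].
rewrite big_mkcond -(pair_bigA _ (fun b' g =>
  if ~~ [disjoint transversal v (b, f) & transversal v (b', g)]
  then N ^ #|transversal v (b, f) :&: transversal v (b', g)| else 0)%N) /=.
rewrite (bigD1 b) //= [X in (_ + X)%N]big1 ?addn0 => [|b' bb'].
  rewrite [X in (_ <= X)%N]big_mkcond /=; apply: leq_sum => g _.
  by rewrite -setI_eq0 -cards_eq0 Einter cards_eq0.
rewrite big1 // => g _.
by rewrite (transversal_disjoint (x := (b, f)) (y := (b', g))) // eq_sym.
Qed.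

(** A proper coloring is injective on a clique, and here its values on A lie in one
    list of size k < |A|. *)
Lemma same_list_clique_uncolorable (V C : finType) (e : rel V) (k : nat)
    (L : {ffun V -> {set C}}) (A : {set V}) :
    {in A &, forall u w, u != w -> e u w} -> (k < #|A|)%N ->
  same_list k L A -> ~~ list_colorable e L.
Proof.
move=> eA kA /existsP[S /andP[SN /forallP LS]].
apply/existsP => -[phi /andP[/forallP prop /forallP mem]].
have inj : {in A &, injective phi}.
  move=> u w uA wA /eqP E; apply/eqP; apply/negPn/negP => uw.
  by have := forallP (prop u) w; rewrite eA //= E.
have : (#|A| <= #|S|)%N.
  rewrite -(card_in_imset inj) subset_leq_card //; apply/subsetP => _ /imsetP[u uA ->].
  by have := LS u; rewrite uA /= => /eqP <-.
by move: SN; rewrite inE => /eqP ->; rewrite leqNgt kA.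
Qed.

Lemma list_prob_le (R : realFieldType) (V C : finType) (k : nat)
    (A B : pred {ffun V -> {set C}}) : (forall L, A L -> B L) ->
  list_prob R k A <= list_prob R k B.
Proof.
move=> AB; rewrite /list_prob [leRHS](bigID A) /= -[leLHS]addr0.
apply: lerD; last by apply: sumr_ge0 => L _; apply: list_mass_ge0.
by rewrite le_eqVlt; apply/orP; left; apply/eqP/eq_bigl => L;
  rewrite andb_idl // => /AB.
Qed.

(** Chebyshev's bound on the probability of colorability, for any graph containing
    B disjoint cliques, or just complete (k + 1)-partite graphs with parts of size
    t. *)
Lemma disjoint_cliques_colorable_le (R : realFieldType) (V C : finType)
    (e : rel V) (k B t : nat) (v : 'I_B * 'I_k.+1 * 'I_t -> V) :
    (k <= #|C|)%N -> (0 < B)%N -> (0 < t)%N -> injective v ->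
    (forall b i j i' j', i != i' -> e (v (b, i, j)) (v (b, i', j'))) ->
  list_prob R k (fun L : {ffun V -> {set C}} => list_colorable e L) *
    (B * t ^ k.+1)%N%:R <= (k.+1 * ('C(#|C|, k) + t) ^ k)%N%:R.
Proof.
move=> kC B0 t0 v_inj clq; rewrite -card_ksubsets.
have N0 := ksubsets_gt0 kC; set N := #|ksubsets C k| in N0 *.
have M0 : (0 < B * t ^ k.+1)%N by rewrite muln_gt0 B0 expn_gt0 t0.
have := second_moment_same_list R kC (ltn0Sn k)
  (fun bf => card_transversal bf v_inj).
set P' := list_prob _ _ _; set P := list_prob _ _ _ => sm.
have PP : P <= P'.
  apply: list_prob_le => L col; apply/forallP => bf; apply/negP => same.
  suff : ~~ list_colorable e L by rewrite col.
  apply: same_list_clique_uncolorable same; last by rewrite card_transversal.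
  move=> _ _ /imsetP[i _ ->] /imsetP[j _ ->] ij; apply: clq.
  by apply: contraNneq ij => ->.
have c0 : 0 < (B * t ^ k.+1 * N)%N%:R :> R by rewrite ltr0n muln_gt0 M0.
rewrite -(ler_pM2r c0) -mulrA -natrM.
apply: (le_trans (ler_wpM2r (ler0n _ _) PP)).
have -> : (B * t ^ k.+1 * (B * t ^ k.+1 * N) =
    #|{: 'I_B * {ffun 'I_k.+1 -> 'I_t}}| ^ 2 * N)%N.
  by rewrite card_prod card_ffun !card_ord -mulnn !mulnA.
apply: (le_trans sm); rewrite -natrM ler_nat.
apply: (leq_trans (sum_transversal_pairs N v_inj)); rewrite /=.
by apply/eq_leq; ring.
Qed.

(** * The disjoint union of cliques *)

(** Cliques on the intervals of m consecutive vertices; the last interval may be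
    shorter, which does not affect the maximum degree as long as m <= n. *)
Definition clique_blocks (m n : nat) : rel 'I_n :=
  fun u w => (u != w) && (u %/ m == w %/ m)%N.

Lemma simple_clique_blocks (m n : nat) : simple_graph (clique_blocks m (n := n)).
Proof.
split=> [u w|u]; rewrite /clique_blocks ?eqxx //.
by rewrite eq_sym [(u %/ m)%N == _]eq_sym.
Qed.

Lemma card_clique_block_le (d n : nat) (u : 'I_n) :
  (#|[set w : 'I_n | u %/ d.+1 == w %/ d.+1]| <= d.+1)%N.
Proof.
rewrite -[X in (_ <= X)%N]card_ord.
rewrite -(card_in_imset (f := fun w : 'I_n => inord (w %% d.+1) : 'I_d.+1)).
  exact: max_card.
move=> w w'; rewrite !inE => /eqP uw /eqP uw' /(congr1 val) /=.
rewrite !inordK ?ltn_pmod // => E; apply/val_inj.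
by rewrite /= (divn_eq w d.+1) (divn_eq w' d.+1) -uw -uw' E.
Qed.

Lemma max_degree_clique_blocks (d n : nat) : (d < n)%N ->
  max_degree (clique_blocks d.+1 (n := n)) = d.
Proof.
move=> dn.
have nbrs (u : 'I_n) : #|[set w | clique_blocks d.+1 u w]| =
    #|[set w : 'I_n | u %/ d.+1 == w %/ d.+1]|.-1%N.
  rewrite (cardsD1 u [set w | _ == _]) inE eqxx /=; apply: eq_card => w.
  by rewrite !inE /clique_blocks eq_sym.
apply/eqP; rewrite eqn_leq; apply/andP; split.
  apply/bigmax_leqP => u _; rewrite nbrs.
  by have := card_clique_block_le d u; lia.
(* The block of the vertex 0 is complete since d < n. *)
pose u0 : 'I_n := Ordinal (leq_trans (ltn0Sn d) dn).
apply: (leq_trans _ (leq_bigmax u0)); rewrite nbrs -ltnS.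
rewrite prednK; last by apply/card_gt0P; exists u0; rewrite inE.
have widen_inj : injective (widen_ord dn).
  by move=> i j /(congr1 val) /= /val_inj.
rewrite -[X in (X <= _)%N]card_ord -(card_imset _ widen_inj).
apply: subset_leq_card; apply/subsetP => _ /imsetP[i _ ->].
by rewrite inE /= div0n divn_small /=.
Qed.

Lemma block_position_lt (n m q : nat)
    (x : 'I_(n %/ m) * 'I_q * 'I_(m %/ q)) :
  (x.1.1 * m + (x.1.2 * (m %/ q) + x.2) < n)%N.
Proof.
case: x => [[b i] j] /=.
have jt := ltn_ord j; have iq := ltn_ord i; have bB := ltn_ord b.
have := leq_divM m q; have := leq_divM n m.
move: (n %/ m)%N (m %/ q)%N b i j jt iq bB => B t b i j jt iq bB nB mt.
have : (b.+1 * m <= B * m)%N by rewrite leq_mul2r bB orbT.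
have : (i.+1 * t <= q * t)%N by rewrite leq_mul2r iq orbT.
by rewrite !mulSn; lia.
Qed.

Definition block_position (n m q : nat)
    (x : 'I_(n %/ m) * 'I_q * 'I_(m %/ q)) : 'I_n :=
  Ordinal (block_position_lt x).

Lemma block_offset_lt (m q i j : nat) :
  (i < q -> j < m %/ q -> i * (m %/ q) + j < m)%N.
Proof.
move=> iq jt; have := leq_divM m q.
have : (i.+1 * (m %/ q) <= q * (m %/ q))%N by rewrite leq_mul2r iq orbT.
by rewrite mulSn; lia.
Qed.

Lemma block_position_div (n m q : nat)
    (x : 'I_(n %/ m) * 'I_q * 'I_(m %/ q)) :
  (block_position x %/ m = x.1.1)%N.
Proof.
have off := block_offset_lt (ltn_ord x.1.2) (ltn_ord x.2).
have m0 : (0 < m)%N by apply: leq_ltn_trans off.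
by rewrite /= divnMDl // (divn_small off) addn0.
Qed.

(** Uniqueness of the quotient and remainder, by m and then by m %/ q. *)
Lemma block_position_inj (n m q : nat) : injective (@block_position n m q).
Proof.
move=> x y xy.
have b_eq : x.1.1 = y.1.1.
  by apply/val_inj; rewrite /= -!block_position_div xy.
move/(congr1 val): xy => /=; rewrite b_eq => /addnI xy.
have t0 : (0 < m %/ q)%N by apply: leq_ltn_trans (ltn_ord x.2).
have i_eq : x.1.2 = y.1.2.
  apply/val_inj; move/(congr1 (divn^~ (m %/ q)%N)): (xy) => /=.
  by rewrite !divnMDl // (divn_small (ltn_ord x.2)) (divn_small (ltn_ord y.2)) !addn0.
have j_eq : x.2 = y.2 by apply/val_inj; move: xy; rewrite i_eq => /addnI.
by case: x y {xy} b_eq i_eq j_eq => [[b i] j] [[b' i'] j'] /= -> -> ->.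
Qed.

Lemma clique_blocks_colorable_le (R : realFieldType) (C : finType)
    (k d n : nat) : (k <= #|C|)%N -> (k <= d)%N -> (d < n)%N ->
  list_prob R k (fun L : {ffun 'I_n -> {set C}} =>
      list_colorable (clique_blocks d.+1 (n := n)) L) *
    (n %/ d.+1 * (d.+1 %/ k.+1) ^ k.+1)%N%:R <=
  (k.+1 * ('C(#|C|, k) + d.+1 %/ k.+1) ^ k)%N%:R.
Proof.
move=> kC kd dn.
apply: (disjoint_cliques_colorable_le _ kC _ _ (@block_position_inj n d.+1 k.+1)).
- by rewrite divn_gt0.
- by rewrite divn_gt0.
move=> b i j i' j' ii'; apply/andP; split; last by rewrite !block_position_div.
by apply: contraNneq ii' => /block_position_inj[->].
Qed.

Lemma bin_le_exp (s k : nat) : ('C(s, k) <= s ^ k)%N.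
Proof.
have : (s ^_ k <= s ^ k)%N.
  elim: k => // k IH; rewrite ffactnSr expnSr.
  by apply: leq_mul IH _; apply: leq_subr.
by apply: leq_trans; rewrite -bin_ffact leq_pmulr ?fact_gt0.
Qed.

Lemma divn_ge_half (m q : nat) : (0 < q <= m)%N -> (m <= 2 * q * (m %/ q))%N.
Proof.
case/andP=> q0 qm; have := ltn_ceil m q0.
have : (q * 1 <= q * (m %/ q))%N by rewrite leq_mul2l divn_gt0 // qm orbT.
rewrite mulSn; nia.
Qed.

Lemma expn_add_le (a b k : nat) : (0 < k)%N ->
  ((a + b) ^ k <= 2 ^ k * (a ^ k + b ^ k))%N.
Proof.
move=> k0; wlog ab : a b / (a <= b)%N.
  by move=> W; case: (leqP a b) => [/W//|/ltnW/W]; rewrite addnC [(b ^ k + _)%N]addnC.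
apply: (@leq_trans ((2 * b) ^ k)); first by rewrite leq_exp2r //; lia.
by rewrite expnMn leq_mul2l leq_addl orbT.
Qed.

(** With q = k + 1: 4 q^2 comes from n <= 4 q (t B) and the factor q in Chebyshev's
    bound, 2^k from splitting (N + t)^k, and (2 q)^k from Delta <= 2 q t. *)
Definition bound_const (k : nat) : nat :=
  (4 * k.+1 ^ 2 * 2 ^ k * (2 * k.+1) ^ k)%N.

(** Both terms of (N + t)^k are treated separately after multiplying the previous
    bound by n t^k: the term t^k yields 1/n, and the term N^k <= sigma^(k^2) yields
    delta. *)
Lemma clique_blocks_colorable_asymp (R : realFieldType) (C : finType)
    (k d n : nat) (delta : R) :
    (0 < k)%N -> (k <= #|C|)%N -> (k <= d)%N -> (d < n)%N ->
    #|C|%:R ^+ (k * k) <= delta * n%:R * d%:R ^+ k ->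
  list_prob R k (fun L : {ffun 'I_n -> {set C}} =>
      list_colorable (clique_blocks d.+1 (n := n)) L) <=
  (bound_const k)%:R * (n%:R^-1 + delta).
Proof.
move=> k0 kC kd dn sigma_le; have := clique_blocks_colorable_le R kC kd dn.
set P := list_prob _ _ _; have P0 : 0 <= P by apply: list_prob_ge0.
set s := #|C| in kC sigma_le *.
set B := (n %/ d.+1)%N; set t := (d.+1 %/ k.+1)%N; set N := 'C(s, k) => main.
have t0 : (0 < t)%N by rewrite divn_gt0.
have m_le : (d.+1 <= 2 * k.+1 * t)%N by apply: divn_ge_half.
have n_le : (n <= 4 * k.+1 * (t * B))%N.
  have : (n <= 2 * d.+1 * B)%N by apply: divn_ge_half.
  move=> /leq_trans; apply.
  have -> : (4 * k.+1 * (t * B) = 2 * (2 * k.+1 * t) * B)%N by ring.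
  by rewrite leq_mul2r leq_mul2l m_le !orbT.
have n0 : 0 < n%:R :> R by rewrite ltr0n (leq_trans _ dn).
have delta0 : 0 <= delta * n%:R * d%:R ^+ k.
  by apply: le_trans sigma_le; rewrite exprn_ge0 ?ler0n.
have tk0 : 0 < t%:R ^+ k :> R by rewrite exprn_gt0 ?ltr0n.
have dn0 : 0 <= delta * n%:R.
  by rewrite pmulr_lge0 // in delta0; rewrite exprn_gt0 // ltr0n (leq_trans k0).
have N_le : (N ^ k)%:R <= delta * n%:R * (2 * k.+1)%:R ^+ k * t%:R ^+ k.
  apply: (@le_trans _ _ (s%:R ^+ (k * k))).
    by rewrite exprM -!natrX ler_nat leq_exp2r // bin_le_exp.
  apply: (le_trans sigma_le); rewrite -[leRHS]mulrA -exprMn -natrM.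
  apply: ler_wpM2l => //; rewrite -!natrX ler_nat leq_exp2r //.
  exact: leq_trans (leqnSn d) m_le.
have step : P * n%:R * t%:R ^+ k <= (4 * k.+1 ^ 2 * 2 ^ k)%:R * (N ^ k + t ^ k)%:R.
  apply: (@le_trans _ _ ((4 * k.+1)%:R * (P * (B * t ^ k.+1)%:R))).
    rewrite -mulrA [leRHS]mulrCA; apply: ler_wpM2l => //.
    rewrite -natrX -!natrM ler_nat expnS.
    have -> : (4 * k.+1 * (B * (t * t ^ k)) = 4 * k.+1 * (t * B) * t ^ k)%N by ring.
    by rewrite leq_mul2r n_le orbT.
  apply: (@le_trans _ _ ((4 * k.+1)%:R * (k.+1 * (N + t) ^ k)%:R)).
    by apply: ler_wpM2l.
  rewrite -!natrM ler_nat.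
  have := expn_add_le N t k0.
  move=> /(leq_mul (leqnn (4 * k.+1 ^ 2))) pow_le.
  by apply: leq_trans (leq_trans pow_le _); apply/eq_leq; ring.
rewrite -(ler_pM2r n0) -(ler_pM2r tk0); apply: (le_trans step).
rewrite /bound_const -natrX in N_le step *.
have D1 : 1 <= ((2 * k.+1) ^ k)%:R :> R by rewrite -[1]/(1%:R) ler_nat expn_gt0.
move: (_ * 2 ^ k)%N ((2 * k.+1) ^ k)%N D1 N_le => c D D1 N_le.
have -> : (c * D)%:R * (n%:R^-1 + delta) * n%:R * t%:R ^+ k =
    c%:R * (delta * n%:R * D%:R * t%:R ^+ k + D%:R * t%:R ^+ k).
  by rewrite natrM; field; rewrite gt_eqF.
rewrite natrD; apply: ler_wpM2l => //; apply: lerD => //.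
by rewrite natrX -[leLHS]mul1r; apply: ler_wpM2r => //; exact: ltW.
Qed.

(** * Asymptotics *)

From mathcomp Require Import all_classical all_reals all_analysis.
Import numFieldNormedType.Exports.
Local Open Scope classical_set_scope.
Local Open Scope ring_scope.

Lemma powR_invn_exprn (R : realType) (a : R) (p : nat) :
  0 <= a -> (0 < p)%N -> (a `^ p%:R^-1) ^+ p = a.
Proof.
move=> a0 p0; rewrite -powR_mulrn ?powR_ge0 // -powRrM mulVf ?powRr1 //.
by rewrite pnatr_eq0 -lt0n.
Qed.

(** As k >= 2, the exponent is at most 1/2, so Delta = O(sqrt n). *)
Lemma degree_lt_near (R : realType) (k : nat) (Delta : nat -> nat) :
    (2 <= k)%N ->
    (fun n : nat => (Delta n)%:R : R) =O_\oo
      (fun n : nat => n%:R `^ (k%:R ^+ 2 - k%:R)^-1) ->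
  \forall n \near \oo, (Delta n < n)%N.
Proof.
move=> k2 /eqO_exP[c c0 Hc]; near=> n.
have n1 : 1 <= n%:R :> R by rewrite ler1n; near: n; exact: nbhs_infty_ge.
have nc : c ^+ 2 < n%:R by near: n; exact: nbhs_infty_gtr.
have dle : `|(Delta n)%:R : R| <= c * `|n%:R `^ (k%:R ^+ 2 - k%:R)^-1 : R|.
  by near: n.
have k2R : 2 <= k%:R :> R by rewrite ler_nat.
have exp_le : (k%:R ^+ 2 - k%:R)^-1 <= 2^-1 :> R.
  by rewrite lef_pV2 ?posrE; nra.
have root_le : n%:R `^ (k%:R ^+ 2 - k%:R)^-1 <= n%:R `^ 2^-1 :> R.
  exact: ler_powR.
rewrite normr_nat ger0_norm ?powR_ge0 // in dle.
(* If n <= Delta n, then n <= c * sqrt n, which contradicts c^2 < n. *)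
rewrite ltnNge; apply/negP => nd.
have : n%:R <= c * n%:R `^ 2^-1 :> R.
  apply: (@le_trans _ _ (Delta n)%:R); first by rewrite ler_nat.
  by apply: (le_trans dle); rewrite ler_pM2l.
have := @powR_invn_exprn R n%:R 2 (ler0n _ _) isT.
have := powR_ge0 (n%:R : R) 2^-1.
move: (n%:R `^ 2^-1 : R) => x x0 xn; rewrite -xn in nc n1 *.
move=> le; suff : x ^+ 2 <= c * c by rewrite leNgt -expr2 nc.
have xc : x <= c by nra.
by nra.
Unshelve. all: by end_near.
Qed.

Theorem mainTheorem3 (R : realType) (k : nat) (hk : (2 <= k)%N)
    (Delta : nat -> nat)
    (Delta_mono : {homo Delta : m n / (m <= n)%N})
    (Delta_infty : Delta n @[n --> \oo] --> \oo)
    (Delta_bigO : (fun n : nat => (Delta n)%:R : R) =O_\oo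
       (fun n : nat => n%:R `^ (k%:R ^+ 2 - k%:R)^-1)) :
  exists (n0 : nat) (H : forall n : nat, rel 'I_n),
    (forall n : nat, (n0 <= n)%N -> (k + 1 <= n)%N ->
       simple_graph (H n) /\ max_degree (H n) = Delta n) /\
    (forall sigma : nat -> nat,
       (forall n : nat, (k <= sigma n)%N) ->
       (fun n : nat => (sigma n)%:R : R) =o_\oo
         (fun n : nat => n%:R `^ (k%:R ^+ 2)^-1 * (Delta n)%:R `^ k%:R^-1) ->
       list_prob R k
         (fun L : {ffun 'I_n -> {set 'I_(sigma n)}} =>
            ~~ list_colorable (H n) L) @[n --> \oo] --> (1 : R)).
Proof.
have k0 : (0 < k)%N by apply: leq_trans hk.
have deg_lt := degree_lt_near hk Delta_bigO.
have [n0 _ Hn0] := deg_lt.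
exists n0, (fun n => clique_blocks (Delta n).+1 (n := n)); split=> [n n0n _|].
  split; first exact: simple_clique_blocks.
  by apply: max_degree_clique_blocks; exact: Hn0.
move=> sigma k_sigma /eqoP sigma_o; apply/cvgrPdist_le => /= e e0.
have K0 : 0 < (bound_const k)%:R :> R.
  by rewrite ltr0n /bound_const !muln_gt0 !expn_gt0.
(* Both terms of the bound 1/n + delta will be at most e / (2 bound_const). *)
pose delta := e / 2 / (bound_const k)%:R.
have delta0 : 0 < delta by rewrite !divr_gt0.
have kk0 : (0 < k * k)%N by rewrite muln_gt0 k0.
have root0 : 0 < delta `^ (k * k)%:R^-1 by exact: powR_gt0.
near=> n.
have dn : (Delta n < n)%N by near: n.
have kd : (k <= Delta n)%N.
  by near: n; exact: (Delta_infty _ (nbhs_infty_ge k)).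
have ninv : n%:R^-1 <= delta.
  rewrite -[leRHS]invrK lef_pV2 ?posrE ?invr_gt0 ?ltr0n ?(leq_trans _ dn) //.
  by near: n; exact: nbhs_infty_ger.
have sig : (#|'I_(sigma n)|)%:R ^+ (k * k) <= delta * n%:R * (Delta n)%:R ^+ k :> R.
  rewrite card_ord.
  have : `|(sigma n)%:R : R| <= delta `^ (k * k)%:R^-1 *
      `|n%:R `^ (k%:R ^+ 2)^-1 * (Delta n)%:R `^ k%:R^-1 : R|.
    by near: n; exact: sigma_o.
  rewrite normr_nat ger0_norm ?mulr_ge0 ?powR_ge0 //.
  move=> /(lerXn2r (k * k)); rewrite !nnegrE ler0n !mulr_ge0 ?powR_ge0 //.
  move=> /(_ isT isT) /le_trans; apply.
  rewrite !exprMn powR_invn_exprn ?(ltW delta0) // -natrX -mulnn.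
  rewrite powR_invn_exprn // exprM powR_invn_exprn //.
  by rewrite mulrA.
have kC : (k <= #|'I_(sigma n)|)%N by rewrite card_ord.
rewrite list_prob_predC // opprB addrC subrK ger0_norm ?list_prob_ge0 //.
apply: (le_trans (clique_blocks_colorable_asymp k0 kC kd dn sig)).
apply: (@le_trans _ _ ((bound_const k)%:R * (delta + delta))).
  by rewrite ler_pM2l // lerD2r.
by rewrite /delta -mulrDl mulrC divfK ?gt_eqF // -splitr.
Unshelve. all: by end_near.
Qed.
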